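(* There exist entangled bipartite pure states $|\psi_1\rangle$ and $|\psi_2\rangle$ that are incomparable, i.e. neither $|\psi_1\rangle\rightarrow|\psi_2\rangle$ nor $|\psi_2\rangle\rightarrow|\psi_1\rangle$ holds, and whose deterministic entanglement exchange rate satisfies $$D(|\psi_1\rangle,|\psi_2\rangle)>1.$$
   Context: All states are bipartite pure states on finite-dimensional spaces. Such a state has a Schmidt decomposition $|\psi\rangle=\sum_{i=1}^n\sqrt{\alpha_i}\,|i\rangle|i\rangle$ with $\alpha_1\ge\dots\ge\alpha_n\ge 0$, $\sum_i\alpha_i=1$; the numbers $\alpha_i$ (without square root) are called its Schmidt coefficients, and $\lambda_\psi=(\alpha_1,\dots,\alpha_n)$ is its ordered Schmidt coefficient vector. The state is entangled if at least two Schmidt coefficients are nonzero (equivalently $\alpha_1<1$). For a tensor product of bipartite states, each party holds the corresponding halves of all factors, so the Schmidt coefficients of $|\psi\rangle\otimes|\phi\rangle$ are all products of a Schmidt coefficient of $|\psi\rangle$ with one of $|\phi\rangle$. Write $|\psi_1\rangle\rightarrow|\psi_2\rangle$ if $|\psi_1\rangle$ can be transformed into $|\psi_2\rangle$ with certainty by local operations and classical communication (LOCC). By Nielsen's theorem (known, may be used as the definition), this holds if and only if $\lambda_{\psi_1}\prec\lambda_{\psi_2}$, i.e. for every $l$ the sum of the $l$ largest components of $\lambda_{\psi_1}$ is at most that of $\lambda_{\psi_2}$ (vectors being padded with zeros to a common length). For entangled states $|\psi_1\rangle,|\psi_2\rangle$ and a positive integer $m$, let $f(m)=\max\{n\geq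 1: |\psi_1\rangle^{\otimes m}\rightarrow|\psi_2\rangle^{\otimes n}\}$, with $f(m)=0$ if this set is empty. The deterministic entanglement exchange rate is $D(|\psi_1\rangle,|\psi_2\rangle)=\sup_{m\ge1}\frac{f(m)}{m}$. *)

(* Defs.v *)
From mathcomp Require Import all_boot all_order all_algebra spectral.
From mathcomp Require Import all_classical all_reals ereal.
From mathcomp Require Import complex mxtens.

Set Implicit Arguments.
Unset Strict Implicit.
Unset Printing Implicit Defensive.

Import Order.TTheory GRing.Theory Num.Theory.
Local Open Scope ring_scope.
Local Open Scope complex_scope.
Local Open Scope classical_set_scope.

Section States.
Context {R : realType}.

(* A vector \sum_(i, j) psi i j |i>|j> of C^a (x) C^b is represented by its
   a x b matrix of amplitudes. *)
Definition pure_state (a b : nat) (psi : 'M[R[i]]_(a, b)) : Prop :=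
  \sum_i \sum_j `|psi i j| ^+ 2 = 1.

(* The Kronecker product of the amplitude matrices groups together the halves
   held by each party: rows are indexed by (C^a)^{(x) k} and columns by
   (C^b)^{(x) k}. *)
Definition tensor_power (a b : nat) (psi : 'M[R[i]]_(a, b)) (k : nat) :
    'M[R[i]]_(a ^ k, b ^ k) :=
  ntensmx psi k.

(* The rows of U and of V are the orthonormal Schmidt vectors: for rectangular
   matrices unitarymx only requires U *m U^t* = 1. The product
   (row k U)^T *m row k V is the amplitude matrix of |u_k>|v_k>. *)
Definition schmidt_decomposition (a b : nat) (psi : 'M[R[i]]_(a, b))
    (s : seq R) : Prop :=
  [/\ sorted >=%R s, {in s, forall x, 0 <= x} &
      exists (U : 'M[R[i]]_(size s, a)) (V : 'M[R[i]]_(size s, b)),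
        [/\ U \is unitarymx, V \is unitarymx &
            psi = \sum_(k < size s)
                    (Num.sqrt s`_k)%:C *: ((row k U)^T *m row k V)]].

(* The singular value decomposition guarantees that such a sequence exists; it
   is unique up to trailing zeros, to which nothing below is sensitive. *)
Definition schmidt_vector (a b : nat) (psi : 'M[R[i]]_(a, b)) : seq R :=
  xget [::] [set s | schmidt_decomposition psi s].

Definition entangled (a b : nat) (psi : 'M[R[i]]_(a, b)) : Prop :=
  (1 < count (fun x => x != 0)%R (schmidt_vector psi))%N.

(* For nonincreasing s and t with equal sums; s`_i = 0 for i >= size s provides
   the padding with zeros. *)
Definition majorized (s t : seq R) : Prop :=
  forall l : nat, \sum_(i < l) s`_i <= \sum_(i < l) t`_i.

(* Convertibility by LOCC, through Nielsen's theorem. *)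
Definition locc (a b c d : nat)
    (psi : 'M[R[i]]_(a, b)) (phi : 'M[R[i]]_(c, d)) : Prop :=
  majorized (schmidt_vector psi) (schmidt_vector phi).

(* The maximum in k is attained whenever the set of candidates is nonempty and
   phi is entangled; the default value 0 then only covers the empty set. *)
Definition max_copies (a b c d : nat)
    (psi : 'M[R[i]]_(a, b)) (phi : 'M[R[i]]_(c, d)) (m : nat) : nat :=
  let convertible n := locc (tensor_power psi m) (tensor_power phi n) in
  xget 0%N [set k | [/\ (1 <= k)%N, convertible k &
                        forall n, (1 <= n)%N -> convertible n -> (n <= k)%N]].

Definition exchange_rate (a b c d : nat)
    (psi : 'M[R[i]]_(a, b)) (phi : 'M[R[i]]_(c, d)) : \bar R :=
  ereal_sup [set ((max_copies psi phi m)%:R / m%:R : R)%:E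
            | m in [set m : nat | (1 <= m)%N]].

End States.

(* Main.v *)
Require Import Defs.
From mathcomp Require Import all_boot all_order all_algebra.
From mathcomp Require Import all_classical all_reals ereal.
From mathcomp Require Import complex.
From Stdlib Require BinNat.
From mathcomp Require Import spectral mxtens zify ring lra.

Set Implicit Arguments.
Unset Strict Implicit.
Unset Printing Implicit Defensive.

Import Order.TTheory GRing.Theory Num.Theory.

(** The witnesses have Schmidt coefficients (11, 11, 1, 1, 1) / 25 and
    (6, 1, 1) / 8. They are incomparable because 11/25 < 6/8 whereas
    22/25 > 7/8, but three copies of the first state can be converted into four
    copies of the second, so that the rate is at least 4/3.

    Majorization is tested through the sums of the positive parts (y - x)^+ over
    the coefficients y: these do not depend on the order of the coefficients,
    and only thresholds x equal to 0 or to a coefficient of the majorizing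
    vector matter. The same sums show that two Schmidt decompositions of one
    state have the same partial sums: the coefficients of one are the image of
    those of the other by a doubly substochastic matrix, to which the convex
    function (y - x)^+ is applied. *)

Local Open Scope ring_scope.

(** * Sums of positive parts and majorization *)

Section Excess.
Context {R : realType}.
Implicit Types (s t : seq R) (x : R).

Definition excess s x : R := \sum_(y <- s) Num.max (y - x) 0.

Lemma excess_ge0 s x : 0 <= excess s x.
Proof. by apply: sumr_ge0 => y _; rewrite le_max lexx orbT. Qed.

(** Each entry satisfies [y <= x + (y - x)^+], whatever the order of [s]; [0 <= x] covers the
    padding zeros. *)
Lemma sum_nth_le_excess s x l :
  0 <= x -> \sum_(i < l) s`_i <= l%:R * x + excess s x.
Proof.
move=> x0; elim: l s => [|l IH] s; first by rewrite big_ord0 mul0r add0r excess_ge0.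
case: s => [|y s].
  rewrite big1 => [|i _]; last by rewrite nth_nil.
  by rewrite addr_ge0 ?mulr_ge0 ?excess_ge0.
rewrite big_ord_recl /= /excess big_cons -/(excess s x) -natr1.
have := IH s; have : y - x <= Num.max (y - x) 0 by rewrite le_max lexx.
lra.
Qed.

(** At the threshold
    [t]_l[the previous bound is tight for sorted]t[: the first]l[entries are at least]t[_l], and the
    later ones have no positive part. *)
Lemma excess_nth_le_sum t l :
  sorted >=%R t -> {in t, forall y, 0 <= y} ->
  l%:R * t`_l + excess t t`_l <= \sum_(i < l) t`_i.
Proof.
elim: l t => [|l IH] [|y t] /=.
- by rewrite big_ord0 mul0r add0r /excess big_nil.
- move=> st _; rewrite big_ord0 mul0r add0r /excess big_cons subrr maxxx add0r.
  rewrite big1_seq // => z /= zt; apply/max_r; rewrite subr_le0.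
  by have /allP/(_ z zt) := order_path_min ge_trans st.
- move=> _ _; rewrite mulr0 add0r /excess big_nil.
  by apply: sumr_ge0 => i _; rewrite nth_nil.
move=> st t0; rewrite big_ord_recl /= /excess big_cons -/(excess t t`_l) -natr1.
have yl : t`_l <= y.
  have [lt|tl] := ltnP l (size t); last by rewrite nth_default // t0 ?mem_head.
  by have /allP/(_ _ (mem_nth 0 lt)) := order_path_min ge_trans st.
rewrite max_l ?subr_ge0 //.
have := IH t (path_sorted st) (fun z zt => t0 z (mem_behead (s := y :: t) zt)).
lra.
Qed.

Lemma majorized_excess s t :
  sorted >=%R t -> {in t, forall y, 0 <= y} ->
  {in 0 :: t, forall x, excess s x <= excess t x} -> majorized s t.
Proof.
move=> st t0 le_st l.
have tl : t`_l \in 0 :: t.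
  have [lt|tl] := ltnP l (size t); last by rewrite nth_default ?mem_head.
  by rewrite inE mem_nth ?orbT.
have tl0 : 0 <= t`_l.
  by move: tl; rewrite inE => /orP[/eqP->//|/t0].
apply: le_trans (excess_nth_le_sum l st t0).
by apply: le_trans (sum_nth_le_excess s l tl0) _; rewrite lerD2l le_st.
Qed.

End Excess.

(** * Uniqueness of Schmidt coefficients *)

Section Uniqueness.
Context {R : realType}.
Local Notation C := R[i].
Local Open Scope complex_scope.
Local Open Scope sesquilinear_scope.

(** The squared modulus as an element of [R], since [|z| ^+ 2] lives in [R[i]]; it serves as a
    weight on real coefficients. *)
Definition normsq (z : C) : R := complex.Re z ^+ 2 + complex.Im z ^+ 2.

Lemma normsq_ge0 z : 0 <= normsq z.
Proof. by rewrite addr_ge0 ?sqr_ge0. Qed.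

Lemma normsqE z : (normsq z)%:C = `|z| ^+ 2.
Proof. exact: add_Re2_Im2. Qed.

Lemma mul_adjoint_diag m n (A : 'M[C]_(m, n)) i :
  (A *m A ^t*) i i = (\sum_j normsq (A i j))%:C.
Proof.
rewrite mxE raddf_sum; apply: eq_bigr => j _.
by rewrite !mxE -normCK -normsqE.
Qed.

Lemma adjointM p q r (A : 'M[C]_(p, q)) (B : 'M[C]_(q, r)) :
  (A *m B) ^t* = B ^t* *m A ^t*.
Proof. by rewrite trmx_mul map_mxM. Qed.

Lemma adjointK p q (A : 'M[C]_(p, q)) : A ^t* ^t* = A.
Proof. by apply/matrixP=> i k; rewrite !mxE conjCK. Qed.

Lemma bessel a m n (X : 'M[C]_(a, n)) (Y : 'M[C]_(m, a)) :
  X ^t* *m X = 1%:M -> Y *m Y ^t* = 1%:M ->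
  forall j, \sum_k normsq ((Y *m X) j k) <= 1.
Proof.
move=> XX YY j.
pose Z := Y - Y *m X *m X ^t*.
have ZZ : Z *m Z ^t* = 1%:M - (Y *m X) *m (Y *m X) ^t*.
  have -> : Z ^t* = Y ^t* - X *m X ^t* *m Y ^t*.
    by rewrite /Z linearB /= map_mxB !adjointM adjointK mulmxA.
  rewrite /Z mulmxBr !mulmxBl !adjointM YY !mulmxA -(mulmxA (Y *m X) (X ^t*) X) XX mulmx1.
  by rewrite subrr subr0.
have := congr1 (fun A : 'M_m => A j j) ZZ.
rewrite mul_adjoint_diag [RHS]mxE [X in _ + X]mxE mul_adjoint_diag mxE eqxx.
rewrite -raddfB => /complexI E; rewrite -subr_ge0 -E.
by apply: sumr_ge0 => k _; apply: normsq_ge0.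
Qed.

(** Conjugating by [X'] gives [diag s' = W (diag s) W^*] with [W = X'^* X], so that [s'_j] is the
    sum of the [|W_jk|^2 s_k]. By Bessel these weights have row and column sums at most 1. *)
Lemma spectral_excess a (s s' : seq R)
    (X : 'M[C]_(a, size s)) (X' : 'M[C]_(a, size s')) (x : R) :
  X ^t* *m X = 1%:M -> X' ^t* *m X' = 1%:M ->
  X *m diag_mx (\row_k (s`_k)%:C) *m X ^t* =
    X' *m diag_mx (\row_k (s'`_k)%:C) *m X' ^t* ->
  0 <= x -> excess s' x <= excess s x.
Proof.
move=> XX XX' eqXX x0; pose W := X' ^t* *m X.
have WE : W ^t* = X ^t* *m X' by rewrite adjointM adjointK.
have diagW : diag_mx (\row_k (s'`_k)%:C) = W *m diag_mx (\row_k (s`_k)%:C) *m W ^t*.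
  transitivity (X' ^t* *m (X *m diag_mx (\row_k (s`_k)%:C) *m X ^t*) *m X').
    by rewrite eqXX !mulmxA XX' mul1mx -mulmxA XX' mulmx1.
  by rewrite WE /W !mulmxA.
have row_le1 j : \sum_k normsq (W j k) <= 1.
  by apply: bessel; rewrite ?adjointK.
have col_le1 k : \sum_j normsq (W j k) <= 1.
  have XXK : X ^t* *m X ^t* ^t* = 1%:M by rewrite adjointK.
  have := bessel XX' XXK k.
  rewrite -WE; apply: le_trans; apply: ler_sum => j _.
  by rewrite -lecR !normsqE !mxE norm_conjC.
have s'E (j : 'I_(size s')) : s'`_j = \sum_k normsq (W j k) * s`_k.
  apply: complexI; have := congr1 (fun A : 'M_(size s') => A j j) diagW.
  rewrite !mxE eqxx mulr1n => ->; rewrite raddf_sum; apply: eq_bigr => k _.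
  by rewrite mul_mx_diag !mxE mulrAC -normCK -normsqE -rmorphM.
rewrite /excess [leLHS](big_nth 0) [leRHS](big_nth 0) !big_mkord.
apply: (@le_trans _ _ (\sum_(j < size s') \sum_(k < size s)
    normsq (W j k) * Num.max (s`_k - x) 0)).
  (* Jensen's inequality in row [j]; as the weights may sum to less than 1, it relies on
     [0 <= x]. *)
  apply: ler_sum => j _; rewrite ge_max; apply/andP; split; last first.
    by apply: sumr_ge0 => k _; rewrite mulr_ge0 ?normsq_ge0 // le_max lexx orbT.
  apply: (@le_trans _ _ (\sum_k normsq (W j k) * (s`_k - x))).
    under [leRHS]eq_bigr do rewrite mulrBr.
    by rewrite sumrB -s'E lerD2l lerN2 -mulr_suml ler_piMl.
  by apply: ler_sum => k _; rewrite ler_wpM2l ?normsq_ge0 // le_max lexx.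
rewrite exchange_big; apply: ler_sum => k _.
by rewrite -mulr_suml ler_piMl // le_max lexx orbT.
Qed.

Lemma schmidt_excess a b (psi : 'M[C]_(a, b)) s s' x :
  schmidt_decomposition psi s -> schmidt_decomposition psi s' ->
  0 <= x -> excess s' x <= excess s x.
Proof.
(* [psi psi^*] is the reduced density matrix of the first party. The square roots and [V] cancel in
   it, so every Schmidt decomposition yields a spectral decomposition of this one matrix. *)
have reduced t : schmidt_decomposition psi t -> exists2 X : 'M[C]_(a, size t),
    X ^t* *m X = 1%:M &
    psi *m psi ^t* = X *m diag_mx (\row_k (t`_k)%:C) *m X ^t*.
  case=> _ t0 [U [V [/unitarymxP UU /unitarymxP VV psiE]]]; exists U^T.
    have := congr1 (map_mx Num.conj) UU.
    rewrite map_mxM map_mx1 => <-; congr (_ *m _).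
      by apply/matrixP=> i k; rewrite !mxE.
    by apply/matrixP=> i k; rewrite !mxE; exact/esym/conjCK.
  pose D : 'M[C]_(size t) := diag_mx (\row_k (Num.sqrt t`_k)%:C).
  have -> : psi = U^T *m D *m V.
    rewrite psiE; apply/matrixP=> i j; rewrite summxE [RHS]mxE; apply: eq_bigr => k _.
    by rewrite mul_mx_diag !mxE big_ord1 !mxE mulrA [_ * U _ _]mulrC.
  have -> : (U^T *m D *m V) ^t* = V ^t* *m D *m (U^T) ^t*.
    rewrite !trmx_mul !map_mxM !mulmxA; congr (_ *m _ *m _).
    apply/matrixP=> i j; rewrite !mxE eq_sym.
    case: eqP => [->|_]; first by rewrite !mulr1n; exact: conjc_real.
    by rewrite !mulr0n; exact: conjc0.
  rewrite !mulmxA -(mulmxA (U^T *m D)) VV mulmx1 -(mulmxA (U^T) D); congr (_ *m _ *m _).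
  apply/matrixP=> i j; rewrite mul_mx_diag !mxE; case: eqP => [->|_].
    by rewrite !mulr1n -rmorphM /= -expr2 sqr_sqrtr ?t0 ?mem_nth.
  by rewrite !mulr0n mul0r.
move=> /reduced[X XX E] /reduced[X' XX' E']; rewrite E in E'.
exact: spectral_excess XX XX' E'.
Qed.

Lemma schmidt_majorized a b (psi : 'M[C]_(a, b)) s s' :
  schmidt_decomposition psi s -> schmidt_decomposition psi s' -> majorized s s'.
Proof.
move=> ds ds'; have [ss' s'0 _] := ds'.
apply: majorized_excess => // x; rewrite inE => /orP[/eqP->|/s'0 x0].
  exact: schmidt_excess ds' ds _.
exact: schmidt_excess ds' ds x0.
Qed.

(** Exhibiting one decomposition keeps [xget] from returning its default [[::]]. *)
Lemma schmidt_vector_decomposition a b (psi : 'M[C]_(a, b)) s :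
  schmidt_decomposition psi s -> schmidt_decomposition psi (schmidt_vector psi).
Proof.
move=> ds; apply: (@xgetPex _ [::] [set t | schmidt_decomposition psi t]%classic).
by exists s.
Qed.

Lemma majorized_trans (s t u : seq R) :
  majorized s t -> majorized t u -> majorized s u.
Proof. by move=> st tu l; apply: le_trans (st l) (tu l). Qed.

(** Lets explicit coefficients replace those picked by choice, since both have the same partial
    sums. *)
Lemma loccP a b c d (psi : 'M[C]_(a, b)) (phi : 'M[C]_(c, d)) s t :
  schmidt_decomposition psi s -> schmidt_decomposition phi t ->
  locc psi phi <-> majorized s t.
Proof.
move=> ds dt; have ds' := schmidt_vector_decomposition ds.
have dt' := schmidt_vector_decomposition dt.
split=> [st|st].
  apply: majorized_trans (schmidt_majorized ds ds') _.
  exact: majorized_trans st (schmidt_majorized dt' dt).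
apply: majorized_trans (schmidt_majorized ds' ds) _.
exact: majorized_trans st (schmidt_majorized dt dt').
Qed.

Lemma entangledP a b (psi : 'M[C]_(a, b)) s :
  schmidt_decomposition psi s -> 0 < s`_1 -> entangled psi.
Proof.
move=> ds s1; have dv := schmidt_vector_decomposition ds.
rewrite /entangled; have [sv v0 _] := dv.
set v := schmidt_vector psi in dv sv v0 *.
have sum2 l : \sum_(i < l) v`_i = \sum_(i < l) s`_i.
  by apply/eqP; rewrite eq_le (schmidt_majorized dv ds) (schmidt_majorized ds dv).
(* The second coefficient is the difference of the partial sums of lengths 2 and 1. *)
have : 0 < v`_1.
  have := sum2 2; have := sum2 1; rewrite !big_ord_recr !big_ord0 /= => e1 e2; lra.
case: v sv v0 {dv sum2} => [|x [|y v]] //=; rewrite ?ltxx // => /andP[yx _] _ y0.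
by rewrite (gt_eqF y0) (gt_eqF (lt_le_trans y0 yx)).
Qed.

End Uniqueness.

(** * Products of coefficients *)

Section Products.

(** For [w] the coefficients of a state, these are the coefficients of its [k]-th tensor power, with
    multiplicity and unsorted. *)
Fixpoint products (A : pzSemiRingType) (w : seq A) (k : nat) : seq A :=
  if k is k'.+1 then [seq x * y | x <- w, y <- products w k'] else [:: 1].

Lemma products1 (A : pzSemiRingType) (w : seq A) : products w 1 = w.
Proof. by rewrite /= allpairs1r map_id_in // => x _; rewrite mulr1. Qed.

Lemma mem_products_exp (A : nzSemiRingType) (w : seq A) x k :
  x \in w -> x ^+ k \in products w k.
Proof.
move=> xw; elim: k => [|k IH] /=; first by rewrite expr0 inE.
by rewrite exprS; apply/allpairsP; exists (x, x ^+ k).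
Qed.

Lemma products_bound (A : numDomainType) (w : seq A) b k :
  0 <= b -> {in w, forall x, 0 <= x <= b} ->
  {in products w k, forall x, 0 <= x <= b ^+ k}.
Proof.
move=> b0 wb; elim: k => [|k IH] z /=.
  by rewrite inE => /eqP->; rewrite ler01 lexx.
case/allpairsP=> -[x y] [/wb/andP[x0 xb] /IH/andP[y0 yb] ->] /=.
by rewrite mulr_ge0 // exprS ler_pM.
Qed.

Lemma products_scaled (A : fieldType) (p : seq nat) (c : A) k :
  products [seq n%:R / c | n <- p] k = [seq n%:R / c ^+ k | n <- products p k].
Proof.
elim: k => [|k IH] /=; first by rewrite expr0 invr1 mulr1.
rewrite IH allpairs_mapl allpairs_mapr map_allpairs; congr flatten.
apply: eq_map => x; apply: eq_map => y.
by rewrite natrM exprS invfM mulrACA.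
Qed.

End Products.

(** * Diagonal states and their tensor powers *)

Section Diagonal.
Context {R : realType}.
Local Notation C := R[i].
Local Open Scope complex_scope.

(** The state whose Schmidt coefficients are the [d i], in any order. *)
Definition diagonal_state n (d : 'I_n -> R) : 'M[C]_n :=
  diag_mx (\row_i (Num.sqrt (d i))%:C).

Lemma diagonal_state_pure n (d : 'I_n -> R) :
  (forall i, 0 <= d i) -> \sum_i d i = 1 -> pure_state (diagonal_state d).
Proof.
move=> d0 d1; rewrite /pure_state -[RHS](rmorph1 (real_complex R)) -d1 raddf_sum.
apply: eq_bigr => i _; rewrite (bigD1 i) //= big1 => [|j ji].
  by rewrite !mxE eqxx mulr1n addr0 -normsqE /normsq /= expr0n addr0 sqr_sqrtr.
by rewrite !mxE eq_sym (negPf ji) mulr0n normr0 expr0n.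
Qed.

Lemma diagonal_state_decomposition n (d : 'I_n -> R) (s : seq R) :
  (forall i, 0 <= d i) -> sorted >=%R s -> perm_eq s (codom d) ->
  schmidt_decomposition (diagonal_state d) s.
Proof.
move=> d0 ss sd.
(* [o] lists the indices by decreasing coefficient; the basis vectors in this order will be the rows
   of [U]. *)
have [o o_perm sE] : exists2 o, perm_eq o (enum 'I_n) & s = map d o.
  exists (sort (relpre d >=%R) (enum 'I_n)); first by rewrite perm_sort.
  rewrite -sort_map; apply: (sorted_eq ge_trans ge_anti ss).
    exact: (sort_sorted ge_total).
  by rewrite perm_sym perm_sort perm_sym.
have o_uniq : uniq o by rewrite (perm_uniq o_perm) enum_uniq.
have o_full j : j \in o by rewrite (perm_mem o_perm) mem_enum.
have size_s : size s = size o by rewrite sE size_map.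
pose U : 'M[C]_(size s, n) := \matrix_(k, j) (index j o == k)%:R.
have U_unitary : U \is unitarymx.
  apply/unitarymxP/matrixP=> k l; rewrite !mxE.
  have [j jk] : exists j, index j o = k.
    have : (k < size o)%N by rewrite -size_s.
    case: {+}o o_uniq => // x o' uo ko.
    by exists (nth x (x :: o') k); rewrite index_uniq.
  rewrite (bigD1 j) //= big1 => [|i ij].
    by rewrite !mxE jk eqxx mul1r addr0 rmorph_nat.
  rewrite !mxE -jk; case: eqP => [E|]; last by rewrite mul0r.
  by rewrite -(nth_index i (o_full i)) E nth_index ?o_full ?eqxx // in ij.
split=> //; first by move=> x; rewrite sE => /mapP[i _ ->].
exists U, U; split=> //; apply/matrixP=> i j; rewrite summxE !mxE.
have i_lt : (index i o < size s)%N by rewrite size_s index_mem.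
rewrite (bigD1 (Ordinal i_lt)) //= big1 => [|k ki]; last first.
  rewrite !mxE big_ord1 !mxE; have -> : (index i o == k) = false.
    by apply: contraNF ki => /eqP E; apply/eqP/val_inj.
  by rewrite mul0r mulr0.
have s_i : s`_(index i o) = d i by rewrite sE (nth_map i) ?index_mem ?nth_index.
rewrite !mxE big_ord1 !mxE eqxx mul1r addr0 /= s_i.
rewrite [X in _ = _ * X](_ : _ = (i == j)%:R) ?mulr_natr //; congr (_%:R).
congr nat_of_bool; apply/eqP/eqP=> [E|->//].
by rewrite -(nth_index i (o_full j)) E nth_index.
Qed.

(** [mxtens_unindex] is a bijection onto the pairs of indices; the order of enumeration is
    immaterial. *)
Lemma codom_tens m n (f : 'I_m -> R) (g : 'I_n -> R) :
  perm_eq (codom (fun k => f (mxtens_unindex k).1 * g (mxtens_unindex k).2))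
    [seq x * y | x <- codom f, y <- codom g].
Proof.
rewrite /codom /image_mem allpairs_mapl allpairs_mapr.
have -> : [seq f (mxtens_unindex k).1 * g (mxtens_unindex k).2 | k <- enum 'I_(m * n)]
    = [seq f ij.1 * g ij.2 | ij <- [seq mxtens_unindex k | k <- enum 'I_(m * n)]].
  by rewrite -map_comp.
rewrite -(map_allpairs (fun ij => f ij.1 * g ij.2) pair); apply: perm_map.
apply: uniq_perm => [||[i j]].
- by rewrite (map_inj_uniq (can_inj (@mxtens_unindexK m n))) enum_uniq.
- by apply: allpairs_uniq => [||[? ?] [? ?] _ _ //]; apply: enum_uniq.
- rewrite allpairs_f ?mem_enum //; apply/mapP.
  by exists (mxtens_index (i, j)); rewrite ?mem_enum ?mxtens_indexK.
Qed.

Lemma tensor_power_diagonal n (d : 'I_n -> R) k : (forall i, 0 <= d i) ->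
  exists e : 'I_(n ^ k) -> R,
    [/\ forall i, 0 <= e i, tensor_power (diagonal_state d) k = diagonal_state e &
        perm_eq (codom e) (products (codom d) k)].
Proof.
move=> d0; case: k => [|k].
  exists (fun=> 1); split=> //.
    by apply/matrixP=> i j; rewrite !mxE sqrtr1.
  by rewrite /= /codom /image_mem expn0 enum_ordSl enum_ord0.
(* The induction starts at one copy, where [n ^ 1] and the tensor power reduce to [n] and the state
   itself, without a trivial factor. *)
elim: k => [|k [e [e0 eE ep]]].
  by exists d; split=> //; rewrite products1.
exists (fun i : 'I_(n * n ^ k.+1) =>
  d (mxtens_unindex i).1 * e (mxtens_unindex i).2); split.
- by move=> i; rewrite mulr_ge0.
- rewrite /tensor_power ntensmxSS -[ntensmx _ k.+1]/(tensor_power _ _) eE.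
  apply/matrixP=> i j; rewrite !mxE sqrtrM // rmorphM /= mulrnAl mulrnAr -mulrnA.
  congr (_ *+ _); rewrite mulnb -(can_eq (@mxtens_unindexK n (n ^ k.+1))) andbC.
  by [].
- apply: perm_trans (codom_tens _ _) _.
  by apply: perm_allpairs_dep => // x _.
Qed.

Lemma tensor_power_decomposition n (d : 'I_n -> R) k : (forall i, 0 <= d i) ->
  schmidt_decomposition (tensor_power (diagonal_state d) k)
    (sort >=%R (products (codom d) k)).
Proof.
move=> d0; have [e [e0 -> ep]] := tensor_power_diagonal k d0.
apply: diagonal_state_decomposition => //; first exact: (sort_sorted ge_total).
by rewrite perm_sort perm_sym.
Qed.

End Diagonal.

(** * Bounds on the number of copies *)

Section Copies.
Context {R : realType}.

Lemma nth0_sort (s : seq R) x : x \in s -> x <= (sort >=%R s)`_0.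
Proof.
rewrite -(mem_sort >=%R).
have := sort_sorted ge_total s; case: (sort _ s) => //= y t st.
rewrite inE => /orP[/eqP->//|xt].
by have /allP/(_ x xt) := order_path_min ge_trans st.
Qed.

(** A form of Bernoulli's inequality making the decay of [b ^+ n] explicit. In the induction,
    [1 + n(1 - b)] exceeds [b (1 + (n + 1)(1 - b))] by exactly [(n + 1)(1 - b)^2]. *)
Lemma bernoulli_exp (b : R) n : 0 <= b <= 1 -> b ^+ n * (1 + n%:R * (1 - b)) <= 1.
Proof.
case/andP=> b0 b1; elim: n => [|n IH]; first by rewrite expr0 mul0r addr0 mulr1.
apply: le_trans IH; rewrite exprSr -mulrA ler_wpM2l ?exprn_ge0 // -natr1.
have : 0 <= n.+1%:R * (1 - b) ^+ 2 by rewrite mulr_ge0 ?sqr_ge0.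
rewrite -natr1; nra.
Qed.

(** Comparing largest coefficients, conversion into [l] copies forces [x^k <= b^l], which fails for
    large [l]. *)
Lemma convertible_copies_bounded m n (d : 'I_m -> R) (e : 'I_n -> R) (x b : R) k :
  (forall i, 0 <= d i) -> (forall i, 0 <= e i <= b) -> 0 <= b < 1 ->
  0 < x -> x \in codom d ->
  exists N, forall l, locc (tensor_power (diagonal_state d) k)
    (tensor_power (diagonal_state e) l) -> (l <= N)%N.
Proof.
move=> d0 eb /andP[b0 b1] x0 xd.
have e0 i : 0 <= e i by case/andP: (eb i).
(* From [x^k <= b^l] and [b^l (1 + l (1 - b)) <= 1] follows [l <= 1 / (x^k (1 - b))]. *)
exists (Num.bound ((x ^+ k * (1 - b))^-1)) => l.
move/(loccP (tensor_power_decomposition k d0) (tensor_power_decomposition l e0)).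
move/(_ 1%N); rewrite !big_ord_recl !big_ord0 !addr0 /= => le01.
have xk0 : 0 < x ^+ k by rewrite exprn_gt0.
have xb : x ^+ k <= b ^+ l.
  apply: le_trans (nth0_sort (mem_products_exp k xd)) _; apply: le_trans le01 _.
  have [lt|ge] := ltnP 0 (size (sort >=%R (products (codom e) l))); last first.
    by rewrite nth_default // exprn_ge0.
  have eb' : {in codom e, forall y, 0 <= y <= b} by move=> _ /codomP[i ->].
  have : (sort >=%R (products (codom e) l))`_0 \in products (codom e) l.
    by rewrite -(mem_sort >=%R) mem_nth.
  by case/(products_bound b0 eb')/andP.
have := @bernoulli_exp b l; rewrite b0 ltW // => /(_ isT) bern.
have le1 : x ^+ k * (l%:R * (1 - b)) <= 1.
  apply: le_trans bern; apply: ler_pM => [|||];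
    rewrite ?(ltW xk0) ?mulr_ge0 ?subr_ge0 ?(ltW b1) //.
  by rewrite lerDr.
have db0 : 0 < x ^+ k * (1 - b) by rewrite mulr_gt0 ?subr_gt0.
rewrite -(ler_nat R); apply: le_trans (ltW (archi_boundP _)); last first.
  by rewrite invr_ge0 ltW.
by rewrite -[leRHS]mul1r ler_pdivlMr // mulrCA.
Qed.

(** The bound [N] ensures that the maximum exists, so that [max_copies] is not the default [0]. *)
Lemma max_copies_ge a b c d (psi : 'M[R[i]]_(a, b)) (phi : 'M[R[i]]_(c, d)) m k N :
  (0 < k)%N -> locc (tensor_power psi m) (tensor_power phi k) ->
  (forall l, locc (tensor_power psi m) (tensor_power phi l) -> (l <= N)%N) ->
  (k <= max_copies psi phi m)%N.
Proof.
move=> k0 conv bnd.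
pose P l := `[< (0 < l)%N /\ locc (tensor_power psi m) (tensor_power phi l) >].
have exP : exists l, P l by exists k; apply/asboolP.
have ubP l : P l -> (l <= N)%N by move/asboolP=> [_ /bnd].
have [M /asboolP[M0 cM] maxM] := ex_maxnP exP ubP.
suff [_ _ ge] : [set k | [/\ (1 <= k)%N, locc (tensor_power psi m) (tensor_power phi k) &
    forall n, (1 <= n)%N -> locc (tensor_power psi m) (tensor_power phi n) ->
      (n <= k)%N]]%classic (max_copies psi phi m) by apply: ge.
apply: xgetPex; exists M; split=> // n n0 cn.
by apply: maxM; apply/asboolP.
Qed.

Lemma exchange_rate_ge a b c d (psi : 'M[R[i]]_(a, b)) (phi : 'M[R[i]]_(c, d)) m :
  (0 < m)%N -> (((max_copies psi phi m)%:R / m%:R)%:E <= exchange_rate psi phi)%E.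
Proof. by move=> m0; apply: ereal_sup_ubound; exists m. Qed.

End Copies.

(** * Deciding majorization of rational vectors *)

Section Rational.
Context {R : realType}.

Definition scaled (p : seq nat) (P : nat) : seq R := [seq n%:R / P%:R | n <- p].

Lemma excess_scaled p P Q y : (0 < P)%N -> (0 < Q)%N ->
  excess (scaled p P) (y%:R / Q%:R) =
    (\sum_(n <- p) (n * Q - y * P))%N%:R / (P * Q)%:R.
Proof.
move=> P0 Q0; rewrite /excess big_map natr_sum mulr_suml; apply: eq_bigr => n _.
have P0' : P%:R != 0 :> R by rewrite pnatr_eq0 -lt0n.
have Q0' : Q%:R != 0 :> R by rewrite pnatr_eq0 -lt0n.
have -> : n%:R / P%:R - y%:R / Q%:R = ((n * Q)%:R - (y * P)%:R) / (P * Q)%:R :> R.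
  by rewrite !natrM; field; rewrite P0' Q0'.
have [le|lt] := leqP (n * Q)%N (y * P)%N.
  rewrite (eqP le) mul0r max_r // mulr_le0_ge0 ?invr_ge0 //.
  by rewrite subr_le0 ler_nat.
rewrite max_l ?natrB ?(ltnW lt) // divr_ge0 //.
by rewrite subr_ge0 ler_nat ltnW.
Qed.

(* Truncated subtraction gives the positive part. *)
Definition excessN (p : seq BinNums.N) (P Q y : BinNums.N) : BinNums.N :=
  foldr (fun n => BinNat.N.add
    (BinNat.N.sub (BinNat.N.mul n Q) (BinNat.N.mul y P))) BinNums.N0 p.

Lemma excessN_sum p P Q y :
  BinNat.N.to_nat (excessN [seq BinNat.N.of_nat n | n <- p] (BinNat.N.of_nat P)
    (BinNat.N.of_nat Q) (BinNat.N.of_nat y)) = (\sum_(n <- p) (n * Q - y * P))%N.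
Proof.
elim: p => [|n p IH]; first by rewrite big_nil.
rewrite big_cons -IH /=; lia.
Qed.

(** At the threshold [y / Q] the two excesses have denominators [P Q] and [Q Q], whence the
    cross-multiplication by [Q] and [P]. Binary numbers keep the evaluation fast. *)
Definition majorizedN (p q : seq BinNums.N) (P Q : BinNums.N) : bool :=
  all (fun y => BinNat.N.leb (BinNat.N.mul (excessN p P Q y) Q)
                             (BinNat.N.mul (excessN q Q Q y) P))
      (BinNums.N0 :: undup q).

Lemma scaled_majorized p q P Q : (0 < P)%N -> (0 < Q)%N ->
  majorizedN [seq BinNat.N.of_nat n | n <- p] [seq BinNat.N.of_nat n | n <- q]
    (BinNat.N.of_nat P) (BinNat.N.of_nat Q) ->
  majorized (sort >=%R (scaled p P)) (sort >=%R (scaled q Q)).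
Proof.
move=> P0 Q0 chk; apply: majorized_excess; first exact: (sort_sorted ge_total).
  by move=> x; rewrite mem_sort => /mapP[n _ ->]; rewrite divr_ge0.
move=> x x_in; have [y y_in ->] : exists2 y, y \in 0%N :: q & x = y%:R / Q%:R.
  move: x_in; rewrite inE => /orP[/eqP->|].
    by exists 0%N; rewrite ?mem_head ?mul0r.
  by rewrite mem_sort => /mapP[n nq ->]; exists n; rewrite // inE nq orbT.
have yN : BinNat.N.of_nat y \in BinNums.N0 :: undup [seq BinNat.N.of_nat n | n <- q].
  move: y_in; rewrite !inE mem_undup => /orP[/eqP->//|yq].
  by rewrite map_f ?orbT.
have le_y := allP chk _ yN.
have {le_y} : (\sum_(n <- p) (n * Q - y * P) * Q <=
    \sum_(n <- q) (n * Q - y * Q) * P)%N.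
  rewrite -!big_distrl /= -!excessN_sum; move: le_y; lia.
rewrite -!big_distrl /= /excess !(perm_big _ (permEl (perm_sort _ _))).
rewrite -/(excess _ _) -/(excess _ _).
rewrite !excess_scaled // -(ler_nat R) !natrM => le_y.
have P0' : 0 < P%:R :> R by rewrite ltr0n.
have Q0' : 0 < Q%:R :> R by rewrite ltr0n.
rewrite ler_pdivrMr ?mulr_gt0 // mulrAC ler_pdivlMr ?mulr_gt0 //.
by rewrite !mulrA ler_pM2r // [leRHS]mulrC -[leRHS]mulrC in le_y *.
Qed.

Lemma products_scaledE p P k : products (scaled p P) k = scaled (products p k) (P ^ k).
Proof. by rewrite /scaled products_scaled natrX. Qed.

End Rational.

(** * The numerical check and the witnesses *)

Lemma alpha3_beta4_majorizedN :
  majorizedN [seq BinNat.N.of_nat n | n <- products [:: 11; 11; 1; 1; 1]%N 3]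
    [seq BinNat.N.of_nat n | n <- products [:: 6; 1; 1]%N 4]
    (BinNat.N.of_nat (25 ^ 3)) (BinNat.N.of_nat (8 ^ 4)).
(* 125 products are tested against 81, at the threshold 0 and at the five distinct numerators [6^j],
   [j <= 4]. *)
Proof. by vm_cast_no_check (erefl true). Qed.

Local Open Scope ereal_scope.

Theorem mainTheorem4 (R : realType) :
  exists (a b c d : nat) (psi1 : 'M[R[i]]_(a, b)) (psi2 : 'M[R[i]]_(c, d)),
    [/\ pure_state psi1 /\ pure_state psi2,
        entangled psi1 /\ entangled psi2,
        ~ locc psi1 psi2 /\ ~ locc psi2 psi1 &
        1 < exchange_rate psi1 psi2].
Proof.
pose p : seq nat := [:: 11; 11; 1; 1; 1]%N; pose q : seq nat := [:: 6; 1; 1]%N.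
pose s : seq R := scaled p 25; pose t : seq R := scaled q 8.
pose d := tnth (in_tuple s); pose e := tnth (in_tuple t).
have cd : codom d = s by rewrite /codom /image_mem map_tnth_enum.
have ce : codom e = t by rewrite /codom /image_mem map_tnth_enum.
have d0 i : (0 <= d i)%R.
  have : d i \in s by exact: mem_tnth.
  by case/mapP=> n _ ->; rewrite divr_ge0.
(* [3 / 4] is the largest coefficient [6 / 8]; being below 1, it bounds the number of copies
   obtainable. *)
have eb i : (0 <= e i <= 3 / 4)%R.
  have : e i \in t by exact: mem_tnth.
  rewrite !inE => /or3P[] /eqP->; apply/andP; split; lra.
have e0 i : (0 <= e i)%R by case/andP: (eb i).
have ds : schmidt_decomposition (diagonal_state d) s.
  apply: diagonal_state_decomposition; rewrite ?cd //=.
  rewrite !andbT; apply/and4P; split; lra.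
have dt : schmidt_decomposition (diagonal_state e) t.
  apply: diagonal_state_decomposition; rewrite ?ce //=.
  rewrite !andbT; apply/andP; split; lra.
exists (size s), (size s), (size t), (size t), (diagonal_state d), (diagonal_state e).
split.
- split; apply: diagonal_state_pure => //.
    rewrite -(big_tnth _ _ s xpredT id) /s /scaled big_map !big_cons big_nil; lra.
  rewrite -(big_tnth _ _ t xpredT id) /t /scaled big_map !big_cons big_nil; lra.
- by split; [apply: (entangledP ds)|apply: (entangledP dt)]; rewrite /=; lra.
- split.
    move/(loccP ds dt)/(_ 2%N); rewrite !big_ord_recl !big_ord0 /=; lra.
  move/(loccP dt ds)/(_ 1%N); rewrite !big_ord_recl !big_ord0 /=; lra.
have conv : locc (tensor_power (diagonal_state d) 3) (tensor_power (diagonal_state e) 4).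
  apply/(loccP (tensor_power_decomposition 3 d0) (tensor_power_decomposition 4 e0)).
  rewrite cd ce !products_scaledE; apply: scaled_majorized.
  - by rewrite expn_gt0.
  - by rewrite expn_gt0.
  - exact: alpha3_beta4_majorizedN.
have [N bnd] : exists N, forall l, locc (tensor_power (diagonal_state d) 3)
    (tensor_power (diagonal_state e) l) -> (l <= N)%N.
  have s0 : (11%:R / 25%:R)%R \in codom d by rewrite cd mem_head.
  apply: (convertible_copies_bounded _ d0 eb _ _ s0); [apply/andP; split|]; lra.
have ge4 := max_copies_ge (isT : (0 < 4)%N) conv bnd.
(* The term [m = 3] of the supremum is at least [4 / 3]. *)
apply: lt_le_trans (exchange_rate_ge _ _ (isT : (0 < 3)%N)).
rewrite lte_fin ltr_pdivlMr // mul1r ltr_nat.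
exact: leq_trans ge4.
Qed.
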